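(* Let $\mathbf{p}=(p_i)_{i\ge1}$ with $p_1=0$, $p_2=1$, $p_i\in(0,1)$ for $i\ge 3$, and $q_i=1-p_i$. The following are equivalent. (i) $\sum_{n=1}^\infty p_n=\infty$ and, as $n\to\infty$, $d_{TV}(\mu\pi^{-1}_n,\mu_n)\to0$, where $\mu_n$ is the law of $(X_1^{n,\mathbf{p}},\dots,X_n^{n,\mathbf{p}})$, $\mu$ is the law of $X^{\infty,\mathbf{p}}$, and $\mu\pi_n^{-1}$ is the image of $\mu$ under the projection $\pi_n(x)=(x_1,\dots,x_n)$. (ii) As $n\to\infty$, $q_n\to0$.
   Context: Random derangement process: for $n\ge 2$, $X^{n,\mathbf{p}}=(X^n_{n+1}=1,X^n_n,\dots,X^n_1)$ is the $\{0,1\}$-valued inhomogeneous Markov chain, run in decreasing index and started from $X^n_{n+1}=1$, such that $X^n_n=0$ a.s., $X^n_1=1$ a.s., and for $2\le r\le n-1$: $\mathbb{P}(X^n_r=0\mid X^n_{r+1}=0)=p_r$, $\mathbb{P}(X^n_r=1\mid X^n_{r+1}=0)=q_r$, $\mathbb{P}(X^n_r=0\mid X^n_{r+1}=1)=1$. When $\sum_jp_j=\infty$ the limits $\varphi_i=\varphi_i(\mathbf{p})=\lim_{n\to\infty}\mathbb{P}(X^n_i=1)$ exist, with $\varphi_1=1$, $\varphi_2=0$ and $\varphi_i\in(0,1)$ for $i\ge3$, and $X^{\infty,\mathbf{p}}=(X_i^\infty)_{i\ge1}$ is then defined as the $\{0,1\}$-valued Markov chain, run in increasing index, with $X_1^\infty=1$,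 $\mathbb{P}(X^\infty_{i+1}=1\mid X^\infty_i=0)=1-\mathbb{P}(X^\infty_{i+1}=0\mid X^\infty_i=0)=\frac{\varphi_{i+1}}{1-\varphi_i}$ and $\mathbb{P}(X^\infty_{i+1}=1\mid X^\infty_i=1)=0$. $d_{TV}$ is total variation distance, equal to half the $\ell^1$ distance for laws on a finite set. *)

(* Defs.v *)
(* MathComp / MathComp-Analysis. *)
From HB Require Import structures.
From mathcomp Require Import all_boot all_order all_algebra.
From mathcomp Require Import all_classical all_reals all_analysis.

Set Implicit Arguments.
Unset Strict Implicit.
Unset Printing Implicit Defensive.

Import Order.TTheory GRing.Theory Num.Theory.
Import numFieldNormedType.Exports.

Local Open Scope classical_set_scope.
Local Open Scope ring_scope.

(* The states 0 and 1 are represented by [false] and [true]. *)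

(* Junk value 0 when [P B = 0]; every use below is guarded by [P B > 0]. *)
Definition cprob d (T : measurableType d) (R : realType) (P : probability T R)
    (A B : set T) : R :=
  fine (P (A `&` B)) / fine (P B).

(* Only the values [z 0], ..., [z k] matter. *)
Definition history d (T : measurableType d) (Z : nat -> T -> bool)
    (z : nat -> bool) (k : nat) : set T :=
  [set w | forall j, (j <= k)%N -> Z j w = z j].

(* [Z 0], ..., [Z N] is a (possibly inhomogeneous) Markov chain. *)
Definition markov_upto d (T : measurableType d) (R : realType)
    (P : probability T R) (Z : nat -> {RV P >-> bool}) (N : nat) : Prop :=
  forall k, (k < N)%N -> forall (z : nat -> bool) (b : bool),
    (0 < P (history Z z k))%E ->
    cprob P [set w | Z k.+1 w = b] (history Z z k) =
    cprob P [set w | Z k.+1 w = b] [set w | Z k w = z k].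

(* [transition P Y X a b t] : P(Y = b | X = a) = t, no condition being imposed
   when the event X = a is null. *)
Definition transition d (T : measurableType d) (R : realType)
    (P : probability T R) (Y X : {RV P >-> bool}) (a b : bool) (t : R) : Prop :=
  (0 < P [set w | X w = a])%E ->
  cprob P [set w | Y w = b] [set w | X w = a] = t.

(* [X n.+1], [X n], ..., [X 1] is the random derangement process X^{n,p}, run
   in decreasing index; the other [X i] are irrelevant. *)
Definition derangement_process d (T : measurableType d) (R : realType)
    (P : probability T R) (p : nat -> R) (n : nat)
    (X : nat -> {RV P >-> bool}) : Prop :=
  [/\ markov_upto (fun k => X (n.+1 - k)%N) n,
      [/\ P [set w | X n.+1 w = true] = 1%E,
          P [set w | X n w = false] = 1%E &
          P [set w | X 1 w = true] = 1%E] &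
      forall r, (2 <= r <= n.-1)%N ->
        [/\ transition (X r) (X r.+1) false false (p r),
            transition (X r) (X r.+1) false true (1 - p r) &
            transition (X r) (X r.+1) true false 1] ].

(* phi_i, the limit as n -> oo of P(X^n_i = 1). *)
Definition phi (R : realType) (d : nat -> measure_display)
    (T : forall n, measurableType (d n)) (P : forall n, probability (T n) R)
    (X : forall n, nat -> {RV (P n) >-> bool}) (i : nat) : R :=
  lim ((fun n => fine (P n [set w | X n i w = true])) @ \oo).

(* [Y 1], [Y 2], ... is the process X^{oo,p}, run in increasing index, with
   [f i] in the role of phi_i; [Y 0] is irrelevant. *)
Definition limit_process d (T : measurableType d) (R : realType)
    (P : probability T R) (f : nat -> R) (Y : nat -> {RV P >-> bool}) : Prop :=
  [/\ forall N, markov_upto (fun k => Y k.+1) N,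
      P [set w | Y 1 w = true] = 1%E &
      forall i, (1 <= i)%N ->
        [/\ transition (Y i.+1) (Y i) false true (f i.+1 / (1 - f i)),
            transition (Y i.+1) (Y i) false false (1 - f i.+1 / (1 - f i)) &
            transition (Y i.+1) (Y i) true true 0] ].

(* {0,1}^{1,2,...} with the product sigma-algebra: [x k] is the coordinate of
   index k + 1. *)
Definition coord (k : nat) (x : nat -> bool) : bool := x k.

Definition cylinders : set (set (nat -> bool)) :=
  \bigcup_k preimage_set_system setT (coord k) measurable.

Definition seq_space := g_sigma_algebraType cylinders.

Lemma measurable_coord k : measurable_fun [set: seq_space] (coord k).
Proof.
move=> _ A mA; rewrite setTI; apply: sub_sigma_algebra.
by exists k => //; exists A => //; rewrite setTI.
Qed.

Definition seq_proj (n : nat) (x : seq_space) : n.-tuple bool :=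
  [tuple coord i x | i < n].

Lemma measurable_seq_proj n : measurable_fun [set: seq_space] (@seq_proj n).
Proof.
apply/measurable_fun_tnthP => i; rewrite (_ : _ \o _ = coord i).
  exact: measurable_coord.
by apply/funext => x /=; rewrite tnth_mktuple.
Qed.

HB.instance Definition _ n :=
  isMeasurableFun.Build _ _ _ _ (@seq_proj n) (@measurable_seq_proj n).

Section paths.
Context d (T : measurableType d) (X : nat -> {mfun T >-> bool}).

(* (X_1, ..., X_n) *)
Definition init_seg (n : nat) (w : T) : n.-tuple bool :=
  [tuple X i.+1 w | i < n].

Lemma measurable_init_seg n : measurable_fun [set: T] (init_seg n).
Proof.
apply/measurable_fun_tnthP => i; rewrite (_ : _ \o _ = X i.+1).
  exact: measurable_funPT.
by apply/funext => x /=; rewrite tnth_mktuple.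
Qed.

HB.instance Definition _ n :=
  isMeasurableFun.Build _ _ _ _ (init_seg n) (@measurable_init_seg n).

(* (X_1, X_2, ...) *)
Definition trajectory (w : T) : seq_space := fun k => X k.+1 w.

Lemma measurable_trajectory : measurable_fun [set: T] trajectory.
Proof.
apply: (@measurability _ _ _ seq_space setT trajectory cylinders) => //.
move=> _ [_ [k _ [A mA <-]] <-].
by rewrite setTI; exact: (measurable_funPT (X k.+1)).
Qed.

HB.instance Definition _ :=
  isMeasurableFun.Build _ _ _ _ trajectory measurable_trajectory.

End paths.

Definition dTV d (T : measurableType d) (R : realType)
    (mu nu : probability T R) : R :=
  sup [set `|fine (mu A) - fine (nu A)| | A in measurable].

(* Main.v *)
(* Both [(X^oo_1, ..., X^oo_n)] and [(X^n_1, ..., X^n_n)], read in decreasing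
   index from [n], are Markov chains with the same transitions (for X^oo this is
   the detailed balance between its forward transitions and phi); the first one
   starts from a Bernoulli variable of parameter phi_n and the second one from 0.
   So their total variation distance lies between phi_n and 2 phi_n, and the
   relation phi_n = q_n (1 - phi_(n+1)) shows that phi_n -> 0 if and only if
   q_n -> 0.

   phi exists because P(X^m_r = 1) and P(X^n_r = 1), for n <= m, obey the same
   recursion in r, which gives |P(X^m_r = 1) - P(X^n_r = 1)| <= q_r ... q_(n-1),
   a product that vanishes as n -> oo when the sum of the p_j diverges. *)
Require Import Defs.
From HB Require Import structures.
From mathcomp Require Import all_boot all_order all_algebra.
From mathcomp Require Import all_classical all_reals all_analysis.
From mathcomp Require Import zify ring lra.

Set Implicit Arguments.
Unset Strict Implicit.
Unset Printing Implicit Defensive.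

Import Order.TTheory GRing.Theory Num.Theory.
Import numFieldNormedType.Exports.

Local Open Scope classical_set_scope.
Local Open Scope ring_scope.

(** * Conditional probabilities and Markov paths of Boolean variables *)

Section bool_variables.
Context d (T : measurableType d) (R : realType) (P : probability T R).
Implicit Types (A B : set T) (X Y : {RV P >-> bool}) (Z : nat -> {RV P >-> bool}).

Lemma measurable_event X b : measurable [set w | X w = b].
Proof. exact: (measurable_funPTI X (Y := [set b])). Qed.
Hint Resolve measurable_event : core.

Lemma prob_fin_num A : measurable A -> P A \is a fin_num.
Proof. exact: fin_num_measure. Qed.

Lemma fine_prob_ge0 A : 0 <= fine (P A).
Proof. exact: fine_ge0. Qed.

Lemma fine_prob_le1 A : measurable A -> fine (P A) <= 1.
Proof.
by move=> mA; rewrite -lee_fin fineK ?prob_fin_num//; exact: probability_le1.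
Qed.

Lemma le_fine_prob A B : measurable A -> measurable B -> A `<=` B ->
  fine (P A) <= fine (P B).
Proof.
move=> mA mB AB; apply: fine_le; rewrite ?prob_fin_num//.
by apply: le_measure; rewrite ?inE.
Qed.

Lemma prob_gt0E A : measurable A -> (0 < P A)%E = (fine (P A) != 0).
Proof.
move=> mA; rewrite -(fineK (prob_fin_num mA)) lte_fin lt_neqAle fine_prob_ge0.
by rewrite andbT eq_sym.
Qed.

Lemma fine_prob_split A X : measurable A -> fine (P A) =
  fine (P (A `&` [set w | X w = true])) + fine (P (A `&` [set w | X w = false])).
Proof.
move=> mA; rewrite -fineD ?prob_fin_num//; try exact: measurableI.
rewrite -measureU; try exact: measurableI.
  congr (fine (P _)); apply/seteqP; split => w /=.
    by move=> Aw; case: (X w); [left|right].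
  by move=> [[]|[]].
by rewrite -subset0 => w /= [[_ ->] []].
Qed.

Lemma fine_prob_false X :
  fine (P [set w | X w = false]) = 1 - fine (P [set w | X w = true]).
Proof.
have := fine_prob_split X (@measurableT _ T).
by rewrite probability_setT !setTI /= => ->; rewrite addrC addKr.
Qed.

Lemma fine_prob_setI_null A B : measurable A -> measurable B ->
  fine (P B) = 0 -> fine (P (A `&` B)) = 0.
Proof.
move=> mA mB PB; apply/eqP; rewrite eq_le fine_prob_ge0 andbT -PB.
by apply: le_fine_prob => //; exact: measurableI.
Qed.

Lemma fine_prob_setI_as A X b : measurable A -> fine (P [set w | X w = b]) = 1 ->
  fine (P (A `&` [set w | X w = b])) = fine (P A).
Proof.
move=> mA Xb; rewrite (fine_prob_split X mA).
have X0 : fine (P [set w | X w = ~~ b]) = 0.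
  by case: b Xb => /=; have := fine_prob_false X; lra.
by case: b Xb X0 => Xb X0; rewrite (fine_prob_setI_null mA _ X0) ?addr0 ?add0r.
Qed.

(** This form needs no positivity guard: if the event [X = a] is null, both sides vanish. *)
Lemma transition_joint Y X a b t : transition Y X a b t ->
  fine (P ([set w | Y w = b] `&` [set w | X w = a])) =
  t * fine (P [set w | X w = a]).
Proof.
rewrite /transition prob_gt0E// /cprob => YX.
have [X0|X0] := eqVneq (fine (P [set w | X w = a])) 0.
  by rewrite X0 mulr0 fine_prob_setI_null.
by rewrite -YX// divfK.
Qed.

Lemma transition_compl Y X a b t :
  transition Y X a b t -> transition Y X a (~~ b) (1 - t).
Proof.
move=> YX Xa; rewrite -(YX Xa) /cprob.
have X0 : fine (P [set w | X w = a]) != 0 by rewrite -prob_gt0E.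
rewrite -[X in X - _](divff X0) -mulrBl; congr (_ / _).
rewrite ![_ `&` [set w | X w = a]]setIC.
by have := fine_prob_split Y (measurable_event X a); case: b {YX} => /=; lra.
Qed.

(** An almost surely constant variable keeps its law under any conditioning. This turns the boundary
    conditions on [X n] and [X 1] into transitions. *)
Lemma transition_as Y X a b b' : fine (P [set w | Y w = b]) = 1 ->
  transition Y X a b' (b' == b)%:R.
Proof.
move=> Yb.
have Xb : transition Y X a b 1.
  rewrite /transition prob_gt0E// /cprob => X0.
  by rewrite setIC fine_prob_setI_as// divff.
have [->//|] := eqVneq b' b => bb'.
have := transition_compl Xb.
by rewrite subrr (_ : b' = ~~ b)//; case: b b' bb' {Yb Xb} => -[].
Qed.

Lemma measurable_path Z (z : nat -> bool) n :
  measurable [set w | forall i, (i < n)%N -> Z i w = z i].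
Proof.
case: n => [|n].
  by rewrite (_ : [set w | _] = setT)//; apply/seteqP; split.
rewrite (_ : [set w | _] = \bigcap_(i < n.+1) [set w | Z i w = z i]).
  by apply: bigcap_measurable => // ; exists 0%N.
by apply/seteqP; split.
Qed.

Lemma measurable_history Z z k : measurable (history Z z k).
Proof. exact: (measurable_path Z z k.+1). Qed.
Hint Resolve measurable_history : core.

(** Chain rule. Once a history is null, so are its extensions, and the product is already 0 by
    induction; hence the unconstrained values of [K] at null states do no harm. *)
Lemma prob_history Z N (K : nat -> bool -> bool -> R) : markov_upto Z N ->
  (forall k a b, (k < N)%N -> transition (Z k.+1) (Z k) a b (K k a b)) ->
  forall (z : nat -> bool) k, (k <= N)%N -> fine (P (history Z z k)) =
    fine (P [set w | Z 0 w = z 0]) * \prod_(0 <= j < k) K j (z j) (z j.+1).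
Proof.
move=> ZN ZK z; elim=> [_|k IH kN].
  rewrite big_nil mulr1; congr (fine (P _)); apply/seteqP; split => w /=.
    exact.
  by move=> ? j; rewrite leqn0 => /eqP ->.
rewrite big_nat_recr//= mulrA -IH 1?ltnW//.
have -> : history Z z k.+1 = [set w | Z k.+1 w = z k.+1] `&` history Z z k.
  apply/seteqP; split => w /=.
    by move=> H; split; [exact: H|move=> j jk; apply: H; exact: leqW].
  by move=> [H1 H2] j; rewrite leq_eqVlt => /predU1P[->//|]; exact: H2.
have [H0|H0] := eqVneq (fine (P (history Z z k))) 0.
  by rewrite H0 mul0r fine_prob_setI_null.
have Hgt0 : (0 < P (history Z z k))%E by rewrite prob_gt0E.
have Zgt0 : (0 < P [set w | Z k w = z k])%E.
  apply: (lt_le_trans Hgt0); apply: le_measure; rewrite ?inE//.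
  by move=> w /(_ k (leqnn k)).
have := ZN _ kN z (z k.+1) Hgt0; rewrite (ZK _ _ _ kN)// /cprob => <-.
by rewrite mulrC divfK.
Qed.

Lemma fine_prob_tuple n (U : {mfun T >-> n.-tuple bool}) (A : set (n.-tuple bool)) :
  (forall t, measurable [set w | U w = t]) ->
  fine (P (U @^-1` A)) = \sum_t (t \in A)%:R * fine (P [set w | U w = t]).
Proof.
move=> mU.
pose F t := if t \in A then [set w | U w = t] else set0.
rewrite (_ : U @^-1` A = \bigcup_(t in setT) F t); last first.
  apply/seteqP; split => w /=.
    by move=> Aw; exists (U w) => //; rewrite /F mem_set.
  by move=> [t _]; rewrite /F; case: ifPn => //; rewrite inE => At /= ->.
rewrite measure_fin_bigcup; last 3 first.
- exact: finite_finset.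
- by move=> s t _ _ [w []]; rewrite /F; case: ifP => // _; case: ifP => // _ /= -> ->.
- by move=> t _; rewrite /F; case: ifP.
rewrite (fsbigE (index_enum _)) ?index_enum_uniq//; last first.
  by move=> t _ /=; rewrite mem_index_enum.
rewrite -sum_fine; last by move=> t _; rewrite /F; case: ifP => _ //; rewrite prob_fin_num.
apply: eq_big => [t|t _]; first by rewrite in_setT.
rewrite /F; case: ifP => _; first by rewrite mul1r.
by rewrite measure0 mul0r.
Qed.

End bool_variables.

(* Transition probabilities from [X_(r+1) = a] to [X_r = b]; for [r = 1] the
   convention [p 1 = 0] makes them the right ones as well. *)
Definition backward_kernel (R : realType) (p : nat -> R) r (a b : bool) : R :=
  if a then (~~ b)%:R else if b then 1 - p r else p r.

(** The factor common to both path laws: the conditional weight of the path given its state at index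
    [n]. Here [z r] is the state at index [r.+1]. *)
Definition path_weight (R : realType) (p : nat -> R) n (z : nat -> bool) : R :=
  \prod_(0 <= r < n.-1) backward_kernel p r.+1 (z r.+1) (z r).

(** * The finite chain: recursion and path law *)

Section derangement.
Context d (T : measurableType d) (R : realType) (P : probability T R).
Context (p : nat -> R) (n : nat) (X : nat -> {RV P >-> bool}).
Hypotheses (p1 : p 1%N = 0) (p2 : p 2%N = 1) (n_ge2 : (2 <= n)%N).
Hypothesis hX : derangement_process p n X.

Local Notation u i := (fine (P [set w | X i w = true])).

Lemma derangement_last : u n = 0.
Proof.
case: hX => _ [_ Xn _] _; have := fine_prob_false (X n).
by rewrite Xn /=; lra.
Qed.

Lemma derangement_first : u 1 = 1.
Proof. by case: hX => _ [_ _ X1] _; rewrite X1. Qed.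

Lemma derangement_rec r : (2 <= r < n)%N -> u r = (1 - p r) * (1 - u r.+1).
Proof.
move=> rn; case: hX => _ _ /(_ r) []; first by lia.
move=> _ /transition_joint H01 /transition_compl /=; rewrite subrr => /transition_joint H11.
rewrite (fine_prob_split (X r.+1) (measurable_event (X r) true)) H11 H01.
by rewrite mul0r add0r fine_prob_false.
Qed.

(** For [n > 2] the recursion has the factor [1 - p 2 = 0]; for [n = 2] this is the condition on the
    last index. *)
Lemma derangement_second : u 2 = 0.
Proof.
have [n2|n2] := leqP n 2; last by rewrite derangement_rec ?n2// p2 subrr mul0r.
have -> : 2%N = n by lia.
exact: derangement_last.
Qed.

Lemma derangement_transition r a b : (1 <= r < n)%N ->
  transition (X r) (X r.+1) a b (backward_kernel p r a b).
Proof.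
case: r => [//|[_|r rn]].
  (* Case [r = 1]: since [X 2] is almost surely 0, the transition from 1 holds vacuously; from 0,
     [p 1 = 0] agrees with X_1 = 1. *)
  case: hX => _ [_ _ X1] _; case: a => [X2|].
    by move: X2; rewrite (prob_gt0E P (measurable_event _ _)) derangement_second eqxx.
  have := @transition_as _ _ _ P (X 1%N) (X 2%N) false true b.
  rewrite X1 /backward_kernel p1 subr0 => /(_ erefl).
  by case: b.
case: hX => _ _ /(_ r.+2) []; first by lia.
move=> H00 H01 H10; case: a; case: b => //=.
by have := transition_compl H10; rewrite subrr.
Qed.

Lemma derangement_path z :
  fine (P [set w | forall i, (i < n)%N -> X i.+1 w = z i]) =
  (~~ z n.-1)%:R * path_weight p n z.
Proof.
(* Time [j] of the chain is index [n.+1 - j]. Its first step leads to X_n = 0 from any state, and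
   [zz 0] is the fixed start X_(n+1) = 1. *)
pose K j a b : R := if j is 0 then (b == false)%:R else backward_kernel p (n - j) a b.
pose zz j := if j is 0 then true else z (n - j)%N.
have hK k a b : (k < n)%N -> transition (X (n.+1 - k.+1)%N) (X (n.+1 - k)%N) a b (K k a b).
  case: k => [_|k kn].
    rewrite subn0 subSS subn0; apply: transition_as.
    by case: hX => _ [_ -> _].
  rewrite subSS subSn; last by lia.
  by apply: derangement_transition; lia.
case: (hX) => hM [Xn1 _ _] _.
have Xt : fine (P [set w | X n.+1 w = true]) = 1 by rewrite Xn1.
transitivity (fine (P (history (fun k => X (n.+1 - k)%N) zz n))).
  (* Intersecting with the almost sure event X_(n+1) = 1 makes the path event a full history. *)
  rewrite -[LHS](fine_prob_setI_as _ Xt); last first.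
    exact: (measurable_path (fun i => X i.+1)).
  congr (fine (P _)); apply/seteqP; split => w /=.
    move=> [Hz Xw] [|j] jn; first by rewrite subn0.
    rewrite subSS /= -Hz; last by lia.
    by congr (X _ w); lia.
  move=> H; split; last by have := H 0%N isT; rewrite subn0.
  move=> i ni; have := H (n - i)%N; rewrite leq_subr => /(_ isT).
  have -> : (n.+1 - (n - i) = i.+1)%N by lia.
  move=> ->; rewrite /zz; case E : (n - i)%N => [|k]; first by lia.
  by rewrite -E; congr z; lia.
rewrite (prob_history hM hK _ (leqnn n)) subn0 Xt mul1r.
(* The first factor, the step to X_n, is the indicator of [z n.-1 = false]; the others, in reversed
   order, form [path_weight]. *)
rewrite big_ltn; last by lia.
rewrite /= subn1; congr (_ * _); first by case: (z _).
rewrite big_nat_rev /path_weight big_add1.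
apply: eq_big_nat => i i_n.
have E : (1 + n - i.+2 = (n - i.+2).+1)%N by lia.
rewrite E /= /zz -E; congr (backward_kernel p _ (z _) (z _)); lia.
Qed.

End derangement.

(** * The limit chain and its time reversal *)

Section limit.
Context d (T : measurableType d) (R : realType) (P : probability T R).
Context (p f : nat -> R) (Y : nat -> {RV P >-> bool}).
Hypotheses (p1 : p 1%N = 0) (f1 : f 1%N = 1) (f2 : f 2%N = 0).
Hypothesis f_neq1 : forall n, (2 <= n)%N -> f n != 1.
Hypothesis f_rec : forall n, (2 <= n)%N -> f n = (1 - p n) * (1 - f n.+1).
Hypothesis hY : limit_process f Y.

Definition forward_kernel i (a b : bool) : R :=
  if a then (~~ b)%:R
  else if b then f i.+1 / (1 - f i) else 1 - f i.+1 / (1 - f i).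

Definition marginal n (a : bool) : R := if a then f n else 1 - f n.

(** For [n >= 2] this is [f_rec] combined with cancelling [1 - f n]. For [n = 1] that denominator is
    0, but [f 1 = 1] and [f 2 = 0] settle the identity. *)
Lemma detailed_balance n a b : (1 <= n)%N ->
  marginal n a * forward_kernel n a b =
  marginal n.+1 b * backward_kernel p n b a.
Proof.
case: n => [//|[_|n _]].
  by rewrite /marginal /forward_kernel /backward_kernel f1 f2 p1; case: a; case: b => /=; ring.
have := f_rec (isT : 2 <= n.+2)%N; have := f_neq1 (isT : 2 <= n.+2)%N.
rewrite eq_sym -subr_eq0 /marginal /forward_kernel /backward_kernel => fn fE.
case: a; case: b => /=; rewrite ?mulr0 ?mulr1//.
- by rewrite fE; ring.
- by rewrite mulrC divfK.
- rewrite mulrBr mulr1 mulrCA divff// mulr1 {1}fE; ring.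
Qed.

Lemma limit_transition i a b : (1 <= i)%N ->
  transition (Y i.+1) (Y i) a b (forward_kernel i a b).
Proof.
move=> i1; case: hY => _ _ /(_ _ i1) [H01 H00 H11].
case: a; case: b => //.
by have := transition_compl H11; rewrite subr0.
Qed.

(** Each use of detailed balance moves the marginal one index up and turns a forward transition into
    a backward one. *)
Lemma limit_path n z : (1 <= n)%N ->
  fine (P [set w | forall i, (i < n)%N -> Y i.+1 w = z i]) =
  marginal n (z n.-1) * path_weight p n z.
Proof.
case: n => // n _.
case: (hY) => /(_ n) hM Y1 _.
transitivity (fine (P (history (fun k => Y k.+1) z n))).
  by congr (fine (P _)); apply/seteqP; split.
rewrite (prob_history (K := fun k => forward_kernel k.+1) hM _ _ (leqnn n)); last first.
  by move=> k a b _; exact: limit_transition.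
have -> : fine (P [set w | Y 1 w = z 0]) = marginal 1 (z 0).
  rewrite /marginal f1; case: (z 0); first by rewrite Y1.
  by rewrite fine_prob_false Y1.
rewrite /path_weight /=; elim: n {hM} => [|n IH]; first by rewrite !big_nil.
rewrite !big_nat_recr//= [LHS]mulrA IH mulrAC detailed_balance//.
by rewrite mulrAC mulrA.
Qed.

Lemma limit_marginal n : (1 <= n)%N -> fine (P [set w | Y n w = true]) = f n.
Proof.
elim: n => [//|[_ _|n IH _]]; first by case: hY => _ -> _; rewrite f1.
rewrite (fine_prob_split (Y n.+1) (measurable_event _ _)).
rewrite !(transition_joint (limit_transition _ (ltn0Sn n))).
rewrite /= mul0r add0r fine_prob_false IH//.
(* Out of index 1 the denominator [1 - f 1] is 0, and the equality rests on [f 2 = 0]. *)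
case: n {IH} => [|n]; first by rewrite f1 f2 !mul0r.
by rewrite divfK// subr_eq0 eq_sym f_neq1.
Qed.

End limit.

(** * Convergence of the recursion and divergence of the series *)

Section analysis.
Context (R : realType).
Implicit Types (p : nat -> R) (u : nat -> nat -> R).

(** By [1 - x <= expR (- x)], the product is at most [expR (s r - s n)], where the partial sums
    [s n] diverge. *)
Lemma cvg_prod_onem p r : (forall i, (1 <= i)%N -> 0 <= p i <= 1) ->
  (\sum_(1 <= k <oo) (p k)%:E = +oo)%E -> (1 <= r)%N ->
  \prod_(r <= j < n) (1 - p j) @[n --> \oo] --> (0 : R).
Proof.
move=> p01 sp r1.
pose s n := \sum_(1 <= k < n) p k.
have soo : s n @[n --> \oo] --> +oo.
  apply/cvgeryP; rewrite -sp.
  have -> : (fun n => (s n)%:E) = (fun n => \sum_(1 <= k < n) (p k)%:E)%E.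
    by apply/funext => n; rewrite sumEFin.
  apply: is_cvg_nneseries => n n1 _; rewrite lee_fin.
  by have /andP[] := p01 _ n1.
apply: (@squeeze_cvgr _ _ _ _ (fun=> 0) (fun n => expR (s r) * expR (- s n))).
- near=> n.
  have rn : (r <= n)%N by near: n; exact: nbhs_infty_ge.
  apply/andP; split.
    rewrite big_nat; apply: prodr_ge0 => j /andP[rj _].
    by have := p01 j (leq_trans r1 rj); lra.
  rewrite -expRD.
  have -> : s r - s n = \sum_(r <= j < n) - p j.
    have -> : s n = s r + \sum_(r <= j < n) p j by rewrite /s -big_cat_nat.
    by rewrite sumrN opprD addNKr.
  rewrite expR_sum !big_nat; apply: ler_prod => j /andP[rj _].
  have := p01 j (leq_trans r1 rj) => pj.
  by rewrite expR_ge1Dx andbT; lra.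
- exact: cvg_cst.
- rewrite -(mulr0 (expR (s r))); apply: cvgMr.
  exact: (cvg_comp _ _ soo (@cvgr_expR R)).
Unshelve. all: by end_near. Qed.

(** At index [n] two values in [0, 1] differ by at most 1, and each step down the common recursion
    multiplies the difference by [-(1 - p i)]. *)
Lemma dist_rec p u r n m : (forall i, (1 <= i)%N -> 0 <= p i <= 1) ->
  (forall n i, (2 <= n)%N -> 0 <= u n i <= 1) ->
  (forall n i, (2 <= i < n)%N -> u n i = (1 - p i) * (1 - u n i.+1)) ->
  (2 <= r <= n)%N -> (n <= m)%N ->
  `|u m r - u n r| <= \prod_(r <= j < n) (1 - p j).
Proof.
move=> p01 u01 urec /andP[r2 rn] nm.
have [k nE] : exists k, n = (r + k)%N by exists (n - r)%N; rewrite subnKC.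
elim: k r r2 rn nE => [|k IH] r r2 rn nE.
  rewrite big_geq ?nE ?addn0//.
  have := u01 m r ltac:(lia); have := u01 r r ltac:(lia).
  by rewrite ler_norml; lra.
rewrite big_ltn; last by lia.
rewrite (urec m r ltac:(lia)) (urec n r ltac:(lia)).
have -> : (1 - p r) * (1 - u m r.+1) - (1 - p r) * (1 - u n r.+1) =
    (1 - p r) * (u n r.+1 - u m r.+1) by ring.
have /p01 pr : (1 <= r)%N by lia.
rewrite normrM ger0_norm; last by lra.
rewrite distrC.
by apply: ler_wpM2l; [lra|apply: IH; lia].
Qed.

Lemma cvg_rec p u r : (forall i, (1 <= i)%N -> 0 <= p i <= 1) ->
  (\sum_(1 <= k <oo) (p k)%:E = +oo)%E ->
  (forall n i, (2 <= n)%N -> 0 <= u n i <= 1) ->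
  (forall n i, (2 <= i < n)%N -> u n i = (1 - p i) * (1 - u n i.+1)) ->
  (2 <= r)%N -> cvgn (fun n => u n r).
Proof.
move=> p01 sp u01 urec r2.
apply: cauchy_cvg; apply: cauchy_exP => e e0.
have /cvgrPdist_lt/(_ e e0)[N _ HN] := cvg_prod_onem p01 sp (ltnW r2).
(* The centre of the Cauchy ball has index at least [N], for a small product, and at least [r], as
   [dist_rec] demands. *)
exists (u (maxn r N) r); exists (maxn r N) => // m /= Nm.
rewrite /ball /= distrC; apply: le_lt_trans.
  apply: (dist_rec p01 u01 urec) Nm; lia.
have := HN (maxn r N); rewrite /= leq_maxr sub0r normrN => /(_ isT).
by apply: le_lt_trans; exact: ler_norm.
Qed.

Lemma sum_pinfty_of_cvg1 p : (forall i, (1 <= i)%N -> 0 <= p i) ->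
  1 - p n @[n --> \oo] --> (0 : R) -> (\sum_(1 <= k <oo) (p k)%:E = +oo)%E.
Proof.
move=> p0 q0.
pose s n := \sum_(1 <= k < n) p k.
have soo : s n @[n --> \oo] --> +oo.
  have /cvgrPdist_lt/(_ 2^-1)[|N _ HN] := q0; first by lra.
  (* From [N] on every term is at least 1/2, so more than [2 * |A|] such terms add up to at least
     [A]. *)
  apply/cvgryPge => A; exists (maxn N 1 + Num.bound (2 * `|A|))%N => // n /= Nn.
  rewrite /s (big_cat_nat (n := maxn N 1))/=; try by lia.
  apply: (@le_trans _ _ (0 + \sum_(maxn N 1 <= i < n) 2^-1)).
    rewrite add0r big_const_nat iter_addr_0.
    set b := Num.bound (2 * `|A|) in Nn *.
    have bA : _ < b%:R := archi_boundP (mulr_ge0 (ler0n R 2) (normr_ge0 A)).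
    have := ler_norm A.
    have : b%:R <= (n - maxn N 1)%:R :> R by rewrite ler_nat; lia.
    by rewrite -mulr_natr; lra.
  apply: lerD.
    by rewrite big_nat; apply: sumr_ge0 => i /andP[i1 _]; exact: p0.
  apply: ler_sum_nat => i /andP[Ni _].
  have /= := HN i; rewrite sub0r normrN => /(_ ltac:(lia)) /ltr_normlP[]; lra.
apply/cvg_lim => //.
have -> : (fun n => \sum_(1 <= k < n) (p k)%:E)%E = (fun n => (s n)%:E).
  by apply/funext => n; rewrite sumEFin.
exact/cvgeryP.
Qed.

End analysis.

(** * Comparison of the two path laws *)

Lemma init_seg_eq d (T : measurableType d) (X : nat -> {mfun T >-> bool}) n
    (t : n.-tuple bool) :
  [set w | init_seg X n w = t] =
  [set w | forall i, (i < n)%N -> X i.+1 w = nth false t i].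
Proof.
apply/seteqP; split => w /=.
  by move=> <- i ni; rewrite -(tnth_nth _ _ (Ordinal ni)) tnth_mktuple.
by move=> H; apply: eq_from_tnth => i; rewrite tnth_mktuple H// -tnth_nth.
Qed.

Section path_comparison.
Context d1 (T1 : measurableType d1) d2 (T2 : measurableType d2) (R : realType).
Context (P1 : probability T1 R) (P2 : probability T2 R).
Context (Y : nat -> {RV P1 >-> bool}) (X : nat -> {RV P2 >-> bool}).
Context (p f : nat -> R) (n : nat).
Hypotheses (n_gt0 : (1 <= n)%N) (fn_ge0 : 0 <= f n).
Hypothesis Yn : fine (P1 [set w | Y n w = true]) = f n.
Hypothesis pathY : forall z,
  fine (P1 [set w | forall i, (i < n)%N -> Y i.+1 w = z i]) =
  marginal f n (z n.-1) * path_weight p n z.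
Hypothesis pathX : forall z,
  fine (P2 [set w | forall i, (i < n)%N -> X i.+1 w = z i]) =
  (~~ z n.-1)%:R * path_weight p n z.

(** One [f n] is the mass [Y] gives to paths with state 1 at index [n]; the other is the relative
    deficit [f n] on the remaining paths, summed against the law of [X]. *)
Lemma path_dist_le (A : set (n.-tuple bool)) :
  `|fine (P1 (init_seg Y n @^-1` A)) - fine (P2 (init_seg X n @^-1` A))|
  <= 2 * f n.
Proof.
have mY t : measurable [set w | init_seg Y n w = t].
  by rewrite init_seg_eq; exact: (measurable_path (fun i => Y i.+1)).
have mX t : measurable [set w | init_seg X n w = t].
  by rewrite init_seg_eq; exact: (measurable_path (fun i => X i.+1)).
pose wY t := fine (P1 [set w | init_seg Y n w = t]).
pose wX t := fine (P2 [set w | init_seg X n w = t]).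
pose L := [set t : n.-tuple bool | nth false t n.-1 = true].
have sumY : \sum_t (t \in L)%:R * wY t = f n.
  rewrite -fine_prob_tuple// -Yn; congr (fine (P1 _)).
  have E w : nth false (init_seg Y n w) n.-1 = Y n w.
    have ln : (n.-1 < n)%N by rewrite prednK.
    by rewrite -(tnth_nth _ _ (Ordinal ln)) tnth_mktuple /= prednK.
  by apply/seteqP; split => w /=; rewrite /L /= E.
have sumX : \sum_t (t \in setT)%:R * wX t = 1.
  by rewrite -fine_prob_tuple// preimage_setT probability_setT.
(* With [W] the path weight, the pair [wY t], [wX t] is [f n * W], [0] on [L] and [(1 - f n) * W],
   [W] off [L]. *)
have dist t : `|wY t - wX t| <= (t \in L)%:R * wY t + f n * wX t.
  have wY0 : 0 <= wY t by exact: fine_prob_ge0.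
  have wX0 : 0 <= wX t by exact: fine_prob_ge0.
  move: wY0 wX0; rewrite /wY /wX !init_seg_eq pathY pathX /marginal.
  have -> : (t \in L) = nth false t n.-1 by apply/idP/idP; rewrite inE.
  case: (nth _ _ _) => /=; rewrite !mul1r ?mul0r.
    by move=> ? _; rewrite subr0 mulr0 addr0 ger0_norm.
  move=> _ W0; rewrite add0r mulrBl mul1r addrAC subrr add0r normrN ger0_norm//.
  exact: mulr_ge0.
rewrite !fine_prob_tuple// -sumrB.
apply: (le_trans (ler_norm_sum _ _ _)).
apply: (@le_trans _ _ (\sum_t ((t \in L)%:R * wY t + f n * ((t \in setT)%:R * wX t)))).
  apply: ler_sum => t _; rewrite -mulrBr normrM in_setT mul1r.
  apply: le_trans (dist t); rewrite ger0_norm ?ler0n//.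
  by case: (t \in A); rewrite ?mul1r// mul0r normr_ge0.
by rewrite big_split -mulr_sumr sumX sumY mulr1 /=; lra.
Qed.

End path_comparison.

(** * Bounds for the total variation distance *)

Section dTV.
Context d (T : measurableType d) (R : realType) (mu nu : probability T R).

Lemma dTV_ge A : measurable A -> `|fine (mu A) - fine (nu A)| <= dTV mu nu.
Proof.
move=> mA; apply: ub_le_sup; last by exists A.
(* A supremum dominates its set only when the set is bounded above; 1 is such a bound. *)
exists 1 => _ [B mB <-].
have := fine_prob_ge0 mu B; have := fine_prob_ge0 nu B.
have := fine_prob_le1 mu mB; have := fine_prob_le1 nu mB.
by rewrite ler_norml; lra.
Qed.

Lemma dTV_le e : (forall A, measurable A -> `|fine (mu A) - fine (nu A)| <= e) ->
  dTV mu nu <= e.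
Proof.
move=> He; apply: ge_sup; last by move=> _ [A mA <-]; exact: He.
by exists `|fine (mu set0) - fine (nu set0)|, set0.
Qed.

End dTV.

(** * Total variation convergence against vanishing of q_n *)

Theorem corollary3 (R : realType) (p : nat -> R)
  (p1 : p 1%N = 0) (p2 : p 2%N = 1)
  (p_ge3 : forall i, (3 <= i)%N -> 0 < p i < 1)
  (d : nat -> measure_display) (T : forall n, measurableType (d n))
  (P : forall n, probability (T n) R)
  (X : forall n, nat -> {RV (P n) >-> bool})
  (hX : forall n, (2 <= n)%N -> derangement_process p n (X n))
  (d' : measure_display) (T' : measurableType d') (P' : probability T' R)
  (Y : nat -> {RV P' >-> bool})
  (hY : (\sum_(1 <= k <oo) (p k)%:E = +oo)%E -> limit_process (phi X) Y) :
  let mu_ n : probability (n.-tuple bool) R := distribution (P n) (init_seg (X n) n) in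
  let mu : probability seq_space R := distribution P' (trajectory Y) in
  ((\sum_(1 <= k <oo) (p k)%:E = +oo)%E /\
    dTV (distribution mu (seq_proj n)) (mu_ n) @[n --> \oo] --> (0 : R))
  <-> (1 - p n @[n --> \oo] --> (0 : R)).
Proof.
move=> mu_ mu.
have p01 i : (1 <= i)%N -> 0 <= p i <= 1.
  case: i => [//|[_|[_|i _]]]; rewrite ?p1 ?p2 ?lexx ?ler01//.
  by have := p_ge3 i.+3 isT; lra.
have p_gt0 i : (2 <= i)%N -> 0 < p i.
  case: i => [//|[//|[_|i _]]]; rewrite ?p2 ?ltr01//.
  by have /andP[] := p_ge3 i.+3 isT.
pose u n i := fine (P n [set w | X n i w = true]).
have u01 n i : 0 <= u n i <= 1.
  by rewrite fine_prob_ge0 fine_prob_le1//; exact: measurable_event.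
have urec n i : (2 <= i < n)%N -> u n i = (1 - p i) * (1 - u n i.+1).
  move=> i2n; have n2 : (2 <= n)%N by lia.
  exact: derangement_rec n2 (hX _ n2) _ i2n.
(* Both sides imply that the series diverges, so divergence may be assumed; it also makes [hY]
   available. *)
suff main : (\sum_(1 <= k <oo) (p k)%:E = +oo)%E ->
    dTV (distribution mu (seq_proj n)) (mu_ n) @[n --> \oo] --> (0 : R) <->
    1 - p n @[n --> \oo] --> (0 : R).
  split=> [[sp /main]|q0]; first exact.
  have sp := sum_pinfty_of_cvg1 (fun i i1 => proj1 (andP (p01 i i1))) q0.
  by split => //; exact/main.
move=> sp; have {hY} hY := hY sp.
have u_cvg i : (2 <= i)%N -> u n i @[n --> \oo] --> phi X i.
  by move=> i2; apply: (cvg_rec p01 sp _ urec).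
have cst_phi i (c : R) : (forall n, (2 <= n)%N -> u n i = c) -> phi X i = c.
  move=> uc; apply: cvg_lim => //.
  apply: cvg_near_cst; near=> n; apply: uc.
  by near: n; exact: nbhs_infty_ge.
have phi1 : phi X 1 = 1 by apply: cst_phi => n n2; exact: derangement_first (hX _ n2).
have phi2 : phi X 2 = 0.
  by apply: cst_phi => n n2; exact: derangement_second p2 n2 (hX _ n2).
have phi_rec i : (2 <= i)%N -> phi X i = (1 - p i) * (1 - phi X i.+1).
  move=> i2; apply: cvg_lim => //.
  have : (1 - p i) * (1 - u n i.+1) @[n --> \oo] --> (1 - p i) * (1 - phi X i.+1).
    by apply: cvgMr; apply: cvgB; [exact: cvg_cst|apply: u_cvg; lia].
  apply: cvg_trans; apply: near_eq_cvg; near=> n.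
  have ni : (i < n)%N by near: n; exact: nbhs_infty_gt.
  by rewrite -/(u n i) [RHS]urec ?i2.
have phi01 i : (2 <= i)%N -> 0 <= phi X i <= 1.
  move=> /u_cvg/cvgP ui; apply/andP; split.
    by apply: (limr_ge ui); near=> n; have /andP[] := u01 n i.
  by apply: (limr_le ui); near=> n; have /andP[] := u01 n i.
(* The recursion with phi_(i+1) >= 0; as p_i > 0, this also keeps the denominators [1 - phi X i]
   nonzero. *)
have phi_le i : (2 <= i)%N -> phi X i <= 1 - p i.
  move=> i2; rewrite phi_rec// -[leRHS]mulr1.
  have := p01 i (ltnW i2); have := phi01 i.+1 (leqW i2) => h1 h2.
  by apply: ler_wpM2l; lra.
have phi_neq1 i : (2 <= i)%N -> phi X i != 1.
  by move=> i2; have := phi_le _ i2; have := p_gt0 _ i2 => *; rewrite lt_eqF//; lra.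
have Yphi n : (1 <= n)%N -> fine (P' [set w | Y n w = true]) = phi X n.
  exact: (limit_marginal phi1 phi2 phi_neq1 hY).
have upper n : (2 <= n)%N -> dTV (distribution mu (seq_proj n)) (mu_ n) <= 2 * phi X n.
  move=> n2; apply: dTV_le => A mA.
  apply: (@path_dist_le _ _ _ _ _ P' (P n) Y (X n) p (phi X) n (ltnW n2)).
  - by have /andP[] := phi01 _ n2.
  - exact: Yphi (ltnW n2).
  - by move=> z; apply: (limit_path p1 phi1 phi2 phi_neq1 phi_rec hY); lia.
  - by move=> z; exact: (derangement_path p1 p2 n2 (hX _ n2)).
(* The test event is state 1 at index [n], that is tuple position [n.-1]: its mass is phi_n in the
   limit law and 0 in the finite one. *)
have lower n : (2 <= n)%N -> phi X n <= dTV (distribution mu (seq_proj n)) (mu_ n).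
  move=> n2; have ln : (n.-1 < n)%N by lia.
  pose A := (fun t : n.-tuple bool => tnth t (Ordinal ln)) @^-1` [set true].
  have mA : measurable A.
    by rewrite -[A]setTI; apply: (measurable_tnth (Ordinal ln)).
  have muA : fine (distribution mu (seq_proj n) A) = phi X n.
    rewrite -Yphi ?(ltnW n2)//; congr (fine (P' _)).
    have E w : tnth (seq_proj n (trajectory Y w)) (Ordinal ln) = Y n w.
      by rewrite tnth_mktuple; congr (Y _ w); rewrite /= prednK// ltnW.
    by apply/seteqP; split => w; rewrite /= /A /= E.
  have nuA : fine (mu_ n A) = 0.
    rewrite -(derangement_last (hX _ n2)); congr (fine (P n _)).
    have E w : tnth (init_seg (X n) n w) (Ordinal ln) = X n n w.
      by rewrite tnth_mktuple /= prednK// ltnW.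
    by apply/seteqP; split => w; rewrite /= /A /= E.
  have := dTV_ge (distribution mu (seq_proj n)) (mu_ n) mA.
  rewrite muA nuA subr0 ger0_norm//.
  by have /andP[] := phi01 _ n2.
split=> [tv0|q0].
- have phi0 : phi X n @[n --> \oo] --> (0 : R).
    apply: (squeeze_cvgr _ (cvg_cst 0) tv0); near=> n.
    have n2 : (2 <= n)%N by near: n; exact: nbhs_infty_ge.
    by rewrite lower//; have /andP[->] := phi01 _ n2.
  (* By the recursion this quotient is q_n. *)
  have : phi X n / (1 - phi X n.+1) @[n --> \oo] --> (0 / (1 - 0) : R).
    apply: cvgM => //; apply: cvgV; first by rewrite subr0 oner_neq0.
    by apply: cvgB; [exact: cvg_cst|rewrite cvg_shiftS].
  rewrite mul0r; apply: cvg_trans; apply: near_eq_cvg; near=> n.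
  have n2 : (2 <= n)%N by near: n; exact: nbhs_infty_ge.
  rewrite {1}phi_rec// mulfK// subr_eq0 eq_sym.
  by apply: phi_neq1; lia.
(* Conversely the distance is at most 2 phi_n, hence at most 2 q_n. *)
- have : 2 * (1 - p n) @[n --> \oo] --> (2 * 0 : R) by apply: cvgMr.
  rewrite mulr0 => h; apply: (squeeze_cvgr _ (cvg_cst 0) h); near=> n.
  have n2 : (2 <= n)%N by near: n; exact: nbhs_infty_ge.
  have /andP[phi_ge0 _] := phi01 _ n2.
  rewrite (le_trans phi_ge0 (lower _ n2)) (le_trans (upper _ n2))//.
  by rewrite ler_pM2l ?phi_le.
Unshelve. all: by end_near. Qed.
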